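(* Negatively associated Gaussian threshold measures are not in general strongly Rayleigh. That is, there exist $n \in \mathbb{N}$, a jointly Gaussian vector $(Z_1,\dots,Z_n)$ and real numbers $a_1,\dots,a_n$ such that the vector $(X_1,\dots,X_n)$ with $X_i = 1_{\{Z_i \geq a_i\}}$ is negatively associated but its law on $\{0,1\}^n$ is not strongly Rayleigh.
   Context: Jointly Gaussian vectors are allowed to be degenerate (singular covariance matrix). A random vector $(X_1,\dots,X_n)$ is negatively associated if $\mathbb{E}[fg] \leq \mathbb{E}[f]\,\mathbb{E}[g]$ for every pair of coordinatewise increasing (i.e. nondecreasing) functions $f$ and $g$ of the vector that depend on disjoint subsets of the components. A probability measure $\mu$ on $\{0,1\}^n$ is strongly Rayleigh if its generating polynomial $f_\mu(z_1,\dots,z_n) = \sum_{I \in \{0,1\}^n} \mu(I) \prod_{i=1}^n z_i^{I_i}$ is real stable, i.e. it has no zeros in $\mathbb{H}^n$, where $\mathbb{H}$ is the open upper half-plane of $\mathbb{C}$. *)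

(* Defs.v *)
From HB Require Import structures.
From mathcomp Require Import all_boot all_order all_algebra.
From mathcomp Require Import complex.
From mathcomp Require Import all_classical all_reals all_analysis measurable_realfun.
From mathcomp Require Import -(notations) mpoly.
Set Implicit Arguments.
Unset Strict Implicit.
Unset Printing Implicit Defensive.
Import Order.TTheory GRing.Theory Num.Theory.
Import numFieldNormedType.Exports.
Local Open Scope classical_set_scope.
Local Open Scope ring_scope.

(* mpoly is imported without its notations, which clash with those of
   MathComp-Analysis: {mpoly R[n]} is mpoly n R, 'X_i is mpolyX R (mnm1 i),
   and p.@[z] is meval z p. *)

Definition real_stable (R : realType) (n : nat) (f : mpoly n R) : Prop :=
  forall z : 'I_n -> R[i], (forall i, 0 < complex.Im (z i)) ->
    meval z (map_mpoly (real_complex R) f) != 0.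

Definition generating_poly (R : realType) (n : nat)
    (mu : {ffun 'I_n -> bool} -> R) : mpoly n R :=
  \sum_(I : {ffun 'I_n -> bool})
    mu I *: \prod_(i < n) mpolyX R (mnm1 i) ^+ I i.

Definition strongly_rayleigh (R : realType) (n : nat)
    (mu : {ffun 'I_n -> bool} -> R) : Prop :=
  real_stable (generating_poly mu).

Section RandomVectors.
Context {d : measure_display} {T : measurableType d} {R : realType}.
Variable P : probability T R.

(* Normal law with mean m and standard deviation s. The case s = 0 is spelled
   out because normal_prob m 0 is the uniform law on [0, 1], not a Dirac mass. *)
Definition gaussian_law (m s : R) : set R -> \bar R :=
  if s == 0 then \d_m else normal_prob m s.

Definition jointly_gaussian (n : nat) (Z : 'I_n -> {RV P >-> R}) : Prop :=
  forall c : 'I_n -> R, exists m s : R, forall A : set R, measurable A ->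
    pushforward P (fun t => \sum_(i < n) c i * Z i t) A = gaussian_law m s A.

Definition coordinatewise_nondecreasing (n : nat) (f : ('I_n -> R) -> R) : Prop :=
  forall x y : 'I_n -> R, (forall i, x i <= y i) -> f x <= f y.

Definition depends_only_on (n : nat) (A : {set 'I_n}) (f : ('I_n -> R) -> R) : Prop :=
  forall x y : 'I_n -> R, (forall i, i \in A -> x i = y i) -> f x = f y.

(* The integrability conditions say that the three expectations exist; they
   hold for all f and g as soon as X takes finitely many values. *)
Definition negatively_associated (n : nat) (X : 'I_n -> {RV P >-> R}) : Prop :=
  forall (A B : {set 'I_n}) (f g : ('I_n -> R) -> R),
    A :&: B = finset.set0 ->
    coordinatewise_nondecreasing f -> coordinatewise_nondecreasing g ->
    depends_only_on A f -> depends_only_on B g ->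
    let fX t := f (fun i => X i t) in
    let gX t := g (fun i => X i t) in
    P.-integrable setT (EFin \o fX) -> P.-integrable setT (EFin \o gX) ->
    P.-integrable setT (EFin \o (fX \* gX)) ->
    ('E_P[fX \* gX] <= 'E_P[fX] * 'E_P[gX])%E.

(* The law of a {0,1}-valued vector X, as a probability mass function. *)
Definition cube_law (n : nat) (X : 'I_n -> {RV P >-> R})
    (I : {ffun 'I_n -> bool}) : R :=
  fine (P [set t | forall i, X i t = (I i)%:R]).

Lemma measurable_superlevel (Y : {RV P >-> R}) (a : R) :
  measurable [set t | a <= Y t].
Proof.
rewrite (_ : [set t | _] = Y @^-1` `[a, +oo[).
  by rewrite -[_ @^-1` _]setTI; exact: measurable_funPT.
by apply/seteqP; split=> t /=; rewrite in_itv /= andbT.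
Qed.

Definition threshold (n : nat) (Z : 'I_n -> {RV P >-> R}) (a : 'I_n -> R)
    (i : 'I_n) : {RV P >-> R} :=
  indic_mfun [set t | a i <= Z i t] (measurable_superlevel (Z i) (a i)).

End RandomVectors.

(* Main.v *)
(* Let U, V be independent standard normal variables and consider the Gaussian
   vector (U, -U-V, V) with thresholds (a, 0, 0), a > 0, that is the events
   U >= a, U + V <= 0 and V >= 0.
   Negative association: each of U and V acts on the three indicators through at
   most two of them and in opposite directions, so that Chebyshev's inequality
   applies first in V for fixed U, and then in U to the expectations over V.
   Not strongly Rayleigh: given U >= a, the second event has small probability,
   at most P(V <= -a). If it had probability zero, the Rayleigh polynomial of
   the first two variables, as a function of the real third variable x, would
   be a product of two affine functions, whose roots differ because U + V <= 0
   and V >= 0 are strictly negatively correlated; it would then take negative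
   values. This persists for large a, and a real x at which the Rayleigh
   polynomial is negative yields a zero of the generating polynomial with all
   coordinates in the upper half-plane. *)
From HB Require Import structures.
Require Import Defs.
From mathcomp Require Import all_boot all_order all_algebra.
From mathcomp Require Import all_classical all_reals all_analysis.
From mathcomp Require Import complex measurable_realfun ring lra.
From mathcomp Require Import -(notations) mpoly.
Set Implicit Arguments.
Unset Strict Implicit.
Unset Printing Implicit Defensive.
Import Order.TTheory GRing.Theory Num.Theory.
Import numFieldNormedType.Exports.
Local Open Scope classical_set_scope.
Local Open Scope ring_scope.

(** * A failure of the Rayleigh inequality yields a zero *)
Definition cube3 (a b c : bool) : {ffun 'I_3 -> bool} :=
  [ffun i : 'I_3 => nth false [:: a; b; c] i].

Lemma big_cube3 (V : nmodType) (F : {ffun 'I_3 -> bool} -> V) :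
  \sum_I F I = \sum_(a : bool) \sum_(b : bool) \sum_(c : bool) F (cube3 a b c).
Proof.
rewrite pair_big pair_big/= (reindex (fun t => cube3 t.1.1 t.1.2 t.2)) //=.
exists (fun I : {ffun 'I_3 -> bool} =>
    (I ord0, I (inord 1), I (inord 2))) => [[[a b] c] _|I _] /=.
  by rewrite !ffunE /= !inordK.
apply/ffunP => i; rewrite ffunE.
case: i => -[|[|[|//]]] i3 /=; congr (I _); apply/val_inj;
  by rewrite /= ?inordK.
Qed.

Lemma meval_generating_poly (R : realType) n (mu : {ffun 'I_n -> bool} -> R)
    (z : 'I_n -> R[i]) :
  meval z (map_mpoly (real_complex R) (generating_poly mu)) =
  \sum_I (mu I)%:C%C * \prod_(i < n) z i ^+ I i.
Proof.
rewrite /generating_poly [map_mpoly _ _]rmorph_sum [meval _ _]rmorph_sum.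
apply: eq_bigr => I _; rewrite /= map_mpolyZ mevalZ.
rewrite [map_mpoly _ _]rmorph_prod [meval _ _]rmorph_prod/=; congr (_ * _).
apply: eq_bigr => i _; rewrite [map_mpoly _ _]rmorphXn [meval _ _]rmorphXn /=.
by rewrite map_mpolyX mevalXU.
Qed.

(** The constant term decides: [e] is at most 1, so that [e ^+ 2 <= e], and so small that
    [e * (|l| + |m|) < - k]. *)
Lemma quadratic_lt0_near0 (R : realFieldType) (k l m : R) :
  k < 0 -> exists2 e, 0 < e & k + e * l + e ^+ 2 * m < 0.
Proof.
move=> k0; set S := `|l| + `|m|; have S0 : 0 <= S by rewrite addr_ge0.
have D0 : 0 < 1 + S - k by lra.
exists (- k / (1 + S - k)); first by rewrite divr_gt0 // oppr_gt0.
set e := - k / _; have e0 : 0 < e by rewrite divr_gt0 // oppr_gt0.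
have e1 : e <= 1 by rewrite ler_pdivrMr //; lra.
have eS : e * S < - k.
  by rewrite /e mulrAC ltr_pdivrMr // ltr_pM2l ?oppr_gt0//; lra.
have el : e * l <= e * `|l| by rewrite ler_pM2l ?ler_norm.
have em : e ^+ 2 * m <= e * `|m|.
  rewrite expr2 -mulrA ler_pM2l//.
  apply: (@le_trans _ _ (e * `|m|)); first by rewrite ler_pM2l ?ler_norm.
  by rewrite ler_piMl.
move: eS; rewrite /S mulrDr; lra.
Qed.

(* The third variable is set to [x + i e] and the first to [i]; the equation
   is then affine in the second variable, and its solution lies in the upper
   half-plane for small [e] because at [e = 0] its imaginary part has the sign
   opposite to that of the Rayleigh difference. *)
Lemma not_strongly_rayleigh3 (R : realType) (mu : {ffun 'I_3 -> bool} -> R)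
    (x : R) :
  let p a b c := mu (cube3 a b c) in
  (p true false false + p true false true * x) *
  (p false true false + p false true true * x) <
  (p false false false + p false false true * x) *
  (p true true false + p true true true * x) ->
  ~ strongly_rayleigh mu.
Proof.
move=> p; rewrite -subr_lt0.
set a := p false false false + _; set b := p true false false + _.
set c := p false true false + _; set d := p true true false + _.
set a1 := p false false true; set b1 := p true false true.
set c1 := p false true true; set d1 := p true true true.
move=> /(@quadratic_lt0_near0 _ _ (a1 * c - b * d1 - a * c1 + b1 * d)
  (b1 * c1 - a1 * d1))[e e0].
(* With the outer variables set to [i] and [x + i e], the polynomial is [n + m y], where
   [n = n1 + i n2] and [m = m1 + i m2]. The quadratic in [e] is the imaginary part of
   [n * conj m]. *)
pose n1 := a - e * b1; pose n2 := b + e * a1.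
pose m1 := c - e * d1; pose m2 := d + e * c1.
rewrite [X in X < 0](_ : _ = n2 * m1 - n1 * m2); last first.
  by rewrite /n1 /n2 /m1 /m2; ring.
move=> im0; pose N := m1 ^+ 2 + m2 ^+ 2.
(* The coefficient [m] is nonzero, as otherwise the negative quantity would vanish. *)
have N0 : 0 < N.
  rewrite lt_def addr_ge0 ?sqr_ge0// andbT; apply: contraTneq im0 => /eqP.
  rewrite paddr_eq0 ?sqr_ge0// !expf_eq0/= => /andP[/eqP-> /eqP->].
  by rewrite !mulr0 subr0 ltxx.
(* Real and imaginary parts of the root [- n / m = - n * conj m / N]. *)
pose y1 := - (n1 * m1 + n2 * m2) / N; pose y2 := - (n2 * m1 - n1 * m2) / N.
pose z (i : 'I_3) := nth 0 [:: 0 +i* 1; y1 +i* y2; x +i* e]%C i.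
move=> /(_ z)/(_ _)/negP; apply.
  case=> -[|[|[|//]]] //= _; rewrite /z/=.
  by rewrite divr_gt0// oppr_gt0.
rewrite meval_generating_poly big_cube3 !big_bool /= !big_ord_recl !big_ord0.
rewrite !ffunE /= /z /= !expr0 !expr1 !mulr1 !mul1r.
rewrite -/(p _ _ _) -!/(p _ _ _).
have rey : y1 * m1 - y2 * m2 + n1 = 0.
  by rewrite /y1 /y2 /N; field; rewrite -/N lt0r_neq0.
have imy : y1 * m2 + y2 * m1 + n2 = 0.
  by rewrite /y1 /y2 /N; field; rewrite -/N lt0r_neq0.
rewrite eq_complex /=; apply/andP; split; apply/eqP.
- by rewrite -[RHS]rey /m1 /m2 /n1 /a /b /c /d /a1 /b1 /c1 /d1; ring.
- by rewrite -[RHS]imy /m1 /m2 /n2 /a /b /c /d /a1 /b1 /c1 /d1; ring.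
Qed.

(** * Negative association from monotonicity *)
Section Chebyshev.
Context d (T : measurableType d) (R : realType) (P : probability T R).

Lemma bounded_integrable (f : T -> R) (M : R) :
  measurable_fun setT f -> (forall x, `|f x| <= M) ->
  P.-integrable setT (EFin \o f).
Proof.
move=> mf fM; apply: measurable_bounded_integrable => //.
  by rewrite [X in (X < _)%E]probability_setT ltry.
exists M; split; rewrite ?num_real// => x Mx y _.
exact: le_trans (fM y) (ltW Mx).
Qed.

Lemma Rintegral_prob_cst (c : R) : \int[P]_(x in setT) c = c.
Proof. by rewrite Rintegral_cst// [X in fine X]probability_setT mulr1. Qed.

Lemma normr_Rintegral_le (f : T -> R) (M : R) :
  measurable_fun setT f -> (forall x, `|f x| <= M) ->
  `|\int[P]_(x in setT) f x| <= M.
Proof.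
move=> mf fM; have fi := bounded_integrable mf fM.
apply: (le_trans (le_normr_Rintegral _ fi)) => //.
rewrite -[leRHS]Rintegral_prob_cst; apply: le_Rintegral => //.
- by apply: (@bounded_integrable _ M) => [|x]; rewrite ?normr_id//;
    exact: measurableT_comp.
- exact: finite_measure_integrable_cst.
Qed.

Variables (f g : T -> R) (M : R).
Hypothesis mf : measurable_fun setT f.
Hypothesis mg : measurable_fun setT g.
Hypothesis fM : forall x, `|f x| <= M.
Hypothesis gM : forall x, `|g x| <= M.

Let If := bounded_integrable mf fM.
Let Ig := bounded_integrable mg gM.

Lemma normrM_le : forall x, `|f x * g x| <= M * M.
Proof. by move=> x; rewrite normrM ler_pM. Qed.

Lemma bounded_integrableM : P.-integrable setT (EFin \o (f \* g)).
Proof.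
apply: (@bounded_integrable (f \* g) (M * M)) normrM_le.
exact: measurable_funM.
Qed.

(** Used once for each variable of a double integral, so that no product measure enters. *)
Lemma le_Rintegral_affine (h : T -> R) (a b c : R) :
  P.-integrable setT (EFin \o h) ->
  (forall x, h x <= a * f x + b * g x + c) ->
  \int[P]_(x in setT) h x <=
  a * \int[P]_(x in setT) f x + b * \int[P]_(x in setT) g x + c.
Proof.
move=> hi hle.
have Iaf : P.-integrable setT (EFin \o (fun x => a * f x)).
  exact: (integrableZl measurableT a If).
have Ibg : P.-integrable setT (EFin \o (fun x => b * g x)).
  exact: (integrableZl measurableT b Ig).
have Ic : P.-integrable setT (EFin \o cst c).
  exact: finite_measure_integrable_cst.
have Is : P.-integrable setT (EFin \o (fun x => a * f x + b * g x)).
  exact: (integrableD measurableT Iaf Ibg).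
rewrite -RintegralZl// -(RintegralZl (f := g))// -RintegralD//.
rewrite -[in leRHS](Rintegral_prob_cst c) -RintegralD//.
by apply: le_Rintegral => //; exact: (integrableD measurableT Is Ic).
Qed.

(** Expanding the sign hypothesis bounds [f y * g y] by an expression affine in [f y] and [g y].
    Integrating in [y] and then in [x] gives twice the claim. *)
Lemma chebyshev_Rintegral :
  (forall x y, (f x - f y) * (g x - g y) <= 0) ->
  \int[P]_(x in setT) (f x * g x) <=
  \int[P]_(x in setT) f x * \int[P]_(x in setT) g x.
Proof.
move=> fg; set F := \int[P]_(x in setT) f x; set G := \int[P]_(x in setT) g x.
have S x : \int[P]_(y in setT) (f y * g y) <= g x * F + f x * G + - (f x * g x).
  apply: le_Rintegral_affine; first exact: bounded_integrableM.
  by move=> y; have := fg x y; lra.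
have : \int[P]_(y in setT) (f y * g y) <=
    G * F + F * G + - \int[P]_(y in setT) (f y * g y).
  apply: le_Rintegral_affine; first exact: bounded_integrableM.
  by move=> x; have := S x; lra.
by lra.
Qed.

End Chebyshev.

(** * Covariance inequality on a product of two probability spaces *)

Section Harris.
Context d1 d2 (T1 : measurableType d1) (T2 : measurableType d2) (R : realType).
Variables (P1 : probability T1 R) (P2 : probability T2 R).

Lemma measurable_Rintegral_section (f : T1 * T2 -> R) (M : R) :
  measurable_fun setT f -> (forall t, `|f t| <= M) ->
  measurable_fun setT (fun x => \int[P2]_(y in setT) f (x, y)).
Proof.
move=> mf fM; have fi := bounded_integrable (P1 \x P2)%E mf fM.
apply: (measurableT_comp (fine_measurable measurableT)).
exact: (measurable_fubini_F fi).
Qed.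

Lemma Rintegral_prod (f : T1 * T2 -> R) (M : R) :
  measurable_fun setT f -> (forall t, `|f t| <= M) ->
  \int[(P1 \x P2)%E]_(t in setT) f t =
  \int[P1]_(x in setT) \int[P2]_(y in setT) f (x, y).
Proof.
move=> mf fM; have fi := bounded_integrable (P1 \x P2)%E mf fM.
rewrite /Rintegral -(integral12_prod_meas1 fi); congr fine.
apply: eq_integral => x _; rewrite /fubini_F fineK//.
apply: integrable_fin_num => //.
apply: (@bounded_integrable _ _ _ P2 _ M) => //.
exact: measurableT_comp.
Qed.

Variables (f g : T1 * T2 -> R) (M : R).
Hypothesis mf : measurable_fun setT f.
Hypothesis mg : measurable_fun setT g.
Hypothesis fM : forall t, `|f t| <= M.
Hypothesis gM : forall t, `|g t| <= M.

(* Conditionally on the first coordinate the covariance is nonpositive, and so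
   is the covariance of the two conditional expectations. *)
Lemma harris_Rintegral :
  (forall x y y', (f (x, y) - f (x, y')) * (g (x, y) - g (x, y')) <= 0) ->
  (forall x x',
    (\int[P2]_(y in setT) f (x, y) - \int[P2]_(y in setT) f (x', y)) *
    (\int[P2]_(y in setT) g (x, y) - \int[P2]_(y in setT) g (x', y)) <= 0) ->
  \int[(P1 \x P2)%E]_(t in setT) (f t * g t) <=
  \int[(P1 \x P2)%E]_(t in setT) f t * \int[(P1 \x P2)%E]_(t in setT) g t.
Proof.
move=> fg2 fg1.
have mfx x : measurable_fun setT (fun y => f (x, y)) by exact: measurableT_comp.
have mgx x : measurable_fun setT (fun y => g (x, y)) by exact: measurableT_comp.
rewrite (@Rintegral_prod (fun t => f t * g t) (M * M)); last 2 first.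
- exact: measurable_funM.
- exact: normrM_le.
rewrite (Rintegral_prod mf fM) (Rintegral_prod mg gM).
have mF := measurable_Rintegral_section mf fM.
have mG := measurable_Rintegral_section mg gM.
have FM x : `|\int[P2]_(y in setT) f (x, y)| <= M by exact: normr_Rintegral_le.
have GM x : `|\int[P2]_(y in setT) g (x, y)| <= M by exact: normr_Rintegral_le.
apply: le_trans (chebyshev_Rintegral P1 mF mG FM GM fg1).
apply: le_Rintegral => //.
- apply: (@bounded_integrable _ _ _ P1 _ (M * M)) => [|x].
    apply: (@measurable_Rintegral_section (f \* g) (M * M)).
      exact: measurable_funM.
    exact: normrM_le.
  apply: normr_Rintegral_le; first exact: measurable_funM.
  by move=> y; exact: normrM_le.
- exact: (bounded_integrableM P1 mF mG FM GM).
- by move=> x _; exact: (chebyshev_Rintegral P2 (mfx x) (mgx x)).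
Qed.

End Harris.

(** The booleans [p0] and [p1] tell whether the index set behind [p] contains the component that
    rises, respectively falls, with the variable; likewise for [q]. Disjointness leaves two cases:
    one function is constant, or the two are monotone in opposite directions. *)
Lemma mulr_opposite_monotone (R : realDomainType) (p q : R -> R)
    (p0 p1 q0 q1 : bool) :
  ~~ (p0 && q0) -> ~~ (p1 && q1) ->
  (~~ p1 -> {homo p : x y / x <= y}) -> (~~ p0 -> {homo p : x y /~ x <= y}) ->
  (~~ q1 -> {homo q : x y / x <= y}) -> (~~ q0 -> {homo q : x y /~ x <= y}) ->
  forall x y, (p x - p y) * (q x - q y) <= 0.
Proof.
move=> pq0 pq1 pi pd qi qd x y; wlog xy : x y / x <= y => [H|].
  by case: (leP x y) => [/H//|/ltW/H]; rewrite -mulrNN !opprB.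
case: p0 p1 q0 q1 pq0 pq1 pi pd qi qd => [] [] [] [] //= _ _ pi pd qi qd;
  try move: (pi isT _ _ xy) => pi'; try move: (pd isT _ _ xy) => pd';
  try move: (qi isT _ _ xy) => qi'; try move: (qd isT _ _ xy) => qd';
  first [ (have -> : p x = p y by lra); by rewrite subrr mul0r
        | (have -> : q x = q y by lra); by rewrite subrr mulr0 | nra].
Qed.

(** Replacing [y] by [x] off [A] keeps [f y] and makes the comparison coordinatewise. *)
Lemma depends_only_on_le (R : realType) (n : nat) (A : {set 'I_n})
    (f : ('I_n -> R) -> R) (x y : 'I_n -> R) :
  coordinatewise_nondecreasing f -> depends_only_on A f ->
  (forall i, i \in A -> x i <= y i) -> f x <= f y.
Proof.
move=> fi fA xy; rewrite (fA y (fun i => if i \in A then y i else x i)).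
  by apply: fi => i; case: ifPn => [/xy|].
by move=> i ->.
Qed.

Section NegativeAssociation.
Context (R : realType) (P1 P2 : probability (measurableTypeR R) R) (n : nat).
Variables (X : 'I_n -> {RV (P1 \x P2)%E >-> R}) (i0 i1 i2 : 'I_n).
Hypothesis X01 : forall i t, 0 <= X i t <= 1.
Hypothesis Xi1 : forall i y, i != i1 ->
  {homo (fun x => X i (x, y)) : x x' / x <= x'}.
Hypothesis Xd1 : forall i y, i != i0 ->
  {homo (fun x => X i (x, y)) : x x' /~ x <= x'}.
Hypothesis Xi2 : forall i x, i != i1 ->
  {homo (fun y => X i (x, y)) : y y' / y <= y'}.
Hypothesis Xd2 : forall i x, i != i2 ->
  {homo (fun y => X i (x, y)) : y y' /~ y <= y'}.

(** In the first coordinate only [X i0] can rise and only [X i1] can fall; in the second, only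
    [X i2] and [X i1]. How [f] varies is thus read off from which of these indices lie in [A], and
    integrating over the second coordinate preserves monotonicity in the first. *)
Lemma negatively_associated_opposite_monotone : negatively_associated X.
Proof.
move=> A B f g AB fi gi fA gB F G intF intG intFG.
have disj i : ~~ ((i \in A) && (i \in B)).
  by rewrite -finset.in_setI AB finset.in_set0.
(* The components lie in [[0, 1]], so a monotone function of them lies between its values at the
   constant vectors 0 and 1; [M] serves both [f] and [g]. *)
pose M := `|f (fun=> 0)| + `|f (fun=> 1)| + (`|g (fun=> 0)| + `|g (fun=> 1)|).
have bound h t : coordinatewise_nondecreasing h ->
    `|h (fun i => X i t)| <= `|h (fun=> 0)| + `|h (fun=> 1)|.
  move=> hi.
  have h0 : h (fun=> 0) <= h (fun i => X i t).
    by apply: hi => i; case/andP: (X01 i t).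
  have h1 : h (fun i => X i t) <= h (fun=> 1).
    by apply: hi => i; case/andP: (X01 i t).
  have := ler_norm (h (fun=> 1)); have := ler_norm (- h (fun=> 0)).
  have := normr_ge0 (h (fun=> 0)); have := normr_ge0 (h (fun=> 1)).
  by rewrite normrN ler_norml; lra.
have FM t : `|F t| <= M by rewrite (le_trans (bound f t fi))// lerDl addr_ge0.
have GM t : `|G t| <= M by rewrite (le_trans (bound g t gi))// lerDr addr_ge0.
(* A monotone function of several variables may fail to be measurable; measurability comes from
   integrability. *)
have mF : measurable_fun setT F.
  by apply/measurable_EFinP; exact: measurable_int intF.
have mG : measurable_fun setT G.
  by apply/measurable_EFinP; exact: measurable_int intG.
have intM (h : measurableTypeR R * measurableTypeR R -> R) :
    measurable_fun setT h -> (forall t, `|h t| <= M) ->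
    forall x, P2.-integrable setT (EFin \o (fun y => h (x, y))).
  move=> mh hM x; apply: (@bounded_integrable _ _ _ P2 _ M) => //.
  exact: measurableT_comp.
rewrite unlock.
rewrite -(fineK (integrable_fin_num _ intF))//.
rewrite -(fineK (integrable_fin_num _ intG))//.
rewrite -(fineK (integrable_fin_num _ intFG))// -EFinM lee_fin.
apply: (harris_Rintegral P1 mF mG FM GM) => [x|x x'].
  apply: (mulr_opposite_monotone (disj i2) (disj i1)).
  - move=> /= A1 y y' yy'; apply: depends_only_on_le fi fA _ => i iA.
    by apply: Xi2 yy'; apply: contraNneq A1 => <-.
  - move=> /= A1 y y' yy'; apply: depends_only_on_le fi fA _ => i iA.
    by apply: Xd2 yy'; apply: contraNneq A1 => <-.
  - move=> /= A1 y y' yy'; apply: depends_only_on_le gi gB _ => i iA.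
    by apply: Xi2 yy'; apply: contraNneq A1 => <-.
  - move=> /= A1 y y' yy'; apply: depends_only_on_le gi gB _ => i iA.
    by apply: Xd2 yy'; apply: contraNneq A1 => <-.
move: x x'; apply: (mulr_opposite_monotone (disj i0) (disj i1)).
- move=> /= A1 x x' xx'; apply: le_Rintegral => //; try exact: intM.
  move=> y _; apply: depends_only_on_le fi fA _ => i iA.
  by apply: Xi1 xx'; apply: contraNneq A1 => <-.
- move=> /= A1 x x' xx'; apply: le_Rintegral => //; try exact: intM.
  move=> y _; apply: depends_only_on_le fi fA _ => i iA.
  by apply: Xd1 xx'; apply: contraNneq A1 => <-.
- move=> /= A1 x x' xx'; apply: le_Rintegral => //; try exact: intM.
  move=> y _; apply: depends_only_on_le gi gB _ => i iA.
  by apply: Xi1 xx'; apply: contraNneq A1 => <-.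
- move=> /= A1 x x' xx'; apply: le_Rintegral => //; try exact: intM.
  move=> y _; apply: depends_only_on_le gi gB _ => i iA.
  by apply: Xd1 xx'; apply: contraNneq A1 => <-.
Qed.

End NegativeAssociation.

(** * Linear combinations of independent normal variables *)
Section Normal.
Context {R : realType}.
Local Notation mu := (@lebesgue_measure R).
Local Notation T := (measurableTypeR R).

(** The density agrees almost everywhere with the Radon-Nikodym derivative, for which the change of
    variables is known. *)
Lemma integral_normal_prob (m s : R) (f : T -> \bar R) : s != 0 ->
  measurable_fun setT f -> (\int[normal_prob m s]_x `|f x| < +oo)%E ->
  (\int[normal_prob m s]_x f x = \int[mu]_x (f x * (normal_pdf m s x)%:E))%E.
Proof.
move=> s0 mf finf; have dom := normal_prob_dominates m s.
rewrite -(Radon_Nikodym_change_of_variables dom)//=; last first.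
  by apply/integrableP; split.
have mpdf : measurable_fun setT (fun x : T => (normal_pdf m s x)%:E).
  by apply/measurable_EFinP; exact: measurable_normal_pdf.
apply: ae_eq_integral => //.
- exact: emeasurable_funM.
- exact: emeasurable_funM.
- apply: ae_eqe_mul2l => /=; rewrite Radon_NikodymE//=.
  case: cid => /= h [h1 h2 h3].
  by apply: integral_ae_eq => //= E _ mE; rewrite -h3.
Qed.

Definition affine (m s : R) (x : T) : T := m + s * x.

Lemma measurable_affine m s : measurable_fun setT (affine m s).
Proof. by apply: measurable_funD => //; exact: measurable_funM. Qed.

Definition affine_lebesgue m s : {measure set T -> \bar R} :=
  measure_function_pushforward__canonical__measure_function_Measure
    mu (measurable_affine m s).

(** The right-hand side is a measure in [A], so by uniqueness of Lebesgue measure half-open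
    intervals suffice. For [s < 0] the preimage is closed on the left instead of the right. *)
Lemma lebesgue_measure_affine (m s : R) (A : set T) : s != 0 -> measurable A ->
  (mu A = `|s|%:E * mu (affine m s @^-1` A))%E.
Proof.
move=> s0 mA.
have s0' : 0 < `|s| by rewrite normr_gt0.
pose k : {nonneg R} := NngNum (ltW s0').
rewrite (@lebesgue_measure_unique R (mscale k (affine_lebesgue m s)))//.
move=> _ [[a b] _ <-]; rewrite /= /mscale /affine_lebesgue /= /pushforward.
rewrite lebesgue_measure_itv /= lte_fin.
move: (s0); rewrite neq_lt => /orP[sN|sP].
- rewrite (_ : _ @^-1` _ = `[(b - m) / s, (a - m) / s[%classic); last first.
    apply/seteqP; split => x /=; rewrite !in_itv/= /affine.
      by rewrite ler_ndivrMr// ltr_ndivlMr//; lra.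
    by rewrite ler_ndivrMr// ltr_ndivlMr//; lra.
  rewrite lebesgue_measure_itv /= lte_fin ltr_nM2r ?invr_lt0// ltrD2r.
  case: ifP => _; last by rewrite mule0.
  by rewrite -EFinB -EFinM ltr0_norm//; congr EFin; field.
- rewrite (_ : _ @^-1` _ = `](a - m) / s, (b - m) / s]%classic); last first.
    apply/seteqP; split => x /=; rewrite !in_itv/= /affine.
      by rewrite ltr_pdivrMr// ler_pdivlMr//; lra.
    by rewrite ltr_pdivrMr// ler_pdivlMr//; lra.
  rewrite lebesgue_measure_itv /= lte_fin ltr_pM2r ?invr_gt0// ltrD2r.
  case: ifP => _; last by rewrite mule0.
  by rewrite -EFinB -EFinM gtr0_norm//; congr EFin; field.
Qed.

Lemma normal_peakE (s : R) :
  normal_peak s = `|s|^-1 * (Num.sqrt (pi *+ 2))^-1.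
Proof. by rewrite /normal_peak -mulrnAr sqrtrM ?sqr_ge0// sqrtr_sqr invfM. Qed.

Lemma normal_pdf_affine (m s x : R) : s != 0 ->
  `|s| * normal_pdf m s (m + s * x) = normal_pdf 0 1 x.
Proof.
move=> s0; rewrite !normal_pdfE ?oner_neq0// !normal_peakE /normal_fun.
rewrite mulrA; congr (_ * expR _).
  by rewrite normr1 invr1 mul1r mulrA divff ?mul1r// normr_eq0.
rewrite expr1n subr0 (addrC m) addrK exprMn; field; exact: s0.
Qed.

(** Lebesgue measure is [|s|] times its image under the affine map; pulled back, this factor turns
    the density into the standard one. *)
Lemma normal_prob_affine (m s : R) (A : set T) : s != 0 -> measurable A ->
  normal_prob 0 1 (affine m s @^-1` A) = normal_prob m s A.
Proof.
move=> s0 mA; have s0' : 0 < `|s| by rewrite normr_gt0.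
pose k : {nonneg R} := NngNum (ltW s0').
have mpdf : measurable_fun setT (fun x : T => (normal_pdf m s x)%:E).
  by apply/measurable_EFinP; exact: measurable_normal_pdf.
have mB : measurable (affine m s @^-1` A).
  by rewrite -[_ @^-1` _]setTI; exact: measurable_affine.
transitivity
    (\int[mscale k (affine_lebesgue m s)]_(x in A) (normal_pdf m s x)%:E)%E;
    last first.
  apply: eq_measure_integral => B mB' _.
  by rewrite [RHS](lebesgue_measure_affine m s0).
rewrite ge0_integral_mscale//=; last 2 first.
- exact: measurable_funTS.
- by move=> x _; rewrite lee_fin normal_pdf_ge0.
rewrite [X in (_ * X)%E]ge0_integral_pushforward//; last 3 first.
- exact: measurable_affine.
- exact: measurable_funTS.
- by move=> x _; rewrite lee_fin normal_pdf_ge0.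
rewrite -ge0_integralZl//=; last 2 first.
- apply: measurable_funTS; apply: (measurableT_comp mpdf).
  exact: measurable_affine.
- by move=> x _; rewrite lee_fin normal_pdf_ge0.
rewrite /normal_prob; apply: eq_integral => x _ /=.
by rewrite -EFinM normal_pdf_affine.
Qed.

(** Both sides are the joint density of [U] and [a U + b V]: on the left conditioned on [U = u], on
    the right on [a U + b V = y]. *)
Lemma normal_pdfM (a b u y : R) : b != 0 ->
  let s := Num.sqrt (a ^+ 2 + b ^+ 2) in
  normal_pdf (a * u) b y * normal_pdf 0 1 u =
  normal_pdf 0 s y * normal_pdf (a * y / s ^+ 2) (b / s) u.
Proof.
move=> b0 s; have s2 : s ^+ 2 = a ^+ 2 + b ^+ 2.
  by rewrite sqr_sqrtr// addr_ge0// sqr_ge0.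
have s2gt0 : 0 < s ^+ 2 by rewrite s2 ltr_wpDl ?sqr_ge0// exprn_even_gt0.
have s0 : s != 0 by move: s2gt0; rewrite exprn_even_gt0.
rewrite !normal_pdfE ?oner_neq0 ?mulf_neq0 ?invr_eq0//.
rewrite !normal_peakE /normal_fun mulrACA [RHS]mulrACA -!expRD.
congr (_ * expR _).
  rewrite normr1 invr1 normrM normfV; field; rewrite !normr_eq0 s0 b0/=.
  by rewrite sqrtr_eq0 -ltNge mulrn_wgt0// pi_gt0.
rewrite expr1n exprMn exprVn s2; field.
rewrite b0 -s2 lt0r_neq0//.
Qed.

(** Given [U = u] the combination is normal with mean [a * u] and deviation [|b|]. After Tonelli,
    [normal_pdfM] isolates a density in [u], whose integral is 1. *)
Lemma normal_prob_linear (a b : R) (A : set T) :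
  b != 0 -> measurable A ->
  (normal_prob 0 1 \x normal_prob 0 1)%E
    [set t : T * T | A (a * t.1 + b * t.2)] =
  normal_prob 0 (Num.sqrt (a ^+ 2 + b ^+ 2)) A.
Proof.
move=> b0 mA; set s := Num.sqrt _.
have s2gt0 : 0 < a ^+ 2 + b ^+ 2 by rewrite ltr_wpDl ?sqr_ge0// exprn_even_gt0.
have s0 : s != 0 by rewrite gt_eqF// sqrtr_gt0.
have mpdf m r : measurable_fun setT (fun x : T => (normal_pdf m r x)%:E).
  by apply/measurable_EFinP; exact: measurable_normal_pdf.
have mlin : measurable_fun setT (fun t : T * T => a * t.1 + b * t.2 : T).
  by apply: measurable_funD; apply: measurable_funM.
have mB : measurable [set t : T * T | A (a * t.1 + b * t.2)].
  by rewrite -[X in measurable X]setTI; exact: mlin.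
have secE x : normal_prob (a * x) b A =
    normal_prob 0 1 (xsection [set t : T * T | A (a * t.1 + b * t.2)] x).
  rewrite -[LHS]normal_prob_affine//; congr (normal_prob 0 1 _).
  by apply/seteqP; split => y /=; rewrite /xsection /= inE.
have mf : measurable_fun setT (fun x : T => normal_prob (a * x) b A).
  under eq_fun do rewrite secE; exact: measurable_fun_xsection.
pose h (t : T * T) : R :=
  \1_A t.2 * (normal_pdf (a * t.1) b t.2 * normal_pdf 0 1 t.1).
have h0 t : 0 <= h t by rewrite /h !mulr_ge0 ?normal_pdf_ge0.
have mh : measurable_fun setT h.
  apply: measurable_funM; first exact: measurableT_comp.
  apply: measurable_funM; last first.
    by apply: measurableT_comp => //; exact: measurable_normal_pdf.
  (* The varying mean is moved into the argument of a centred density, which gives joint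
     measurability. *)
  rewrite [X in measurable_fun _ X](_ : _ =
      normal_pdf 0 b \o (fun t : T * T => t.2 - a * t.1 : T)); last first.
    by apply/funext => t /=; rewrite !normal_pdfE// /normal_fun subr0.
  apply: measurableT_comp; first exact: measurable_normal_pdf.
  by apply: measurable_funB => //; exact: measurable_funM.
rewrite /product_measure1 /=.
under eq_integral do rewrite /= -secE.
rewrite integral_normal_prob ?oner_neq0//; last first.
  apply: (@le_lt_trans _ _ (\int[normal_prob 0 1]_(x in @setT T) 1)%E).
    apply: ge0_le_integral => //=; first exact: measurableT_comp.
    by move=> x _; rewrite gee0_abs// probability_le1.
  by rewrite integral_cst// mul1e [X in (X < _)%E]probability_setT ltry.
transitivity (\int[mu]_x \int[mu]_y (h (x, y))%:E)%E.
  apply: eq_integral => x _; rewrite /normal_prob integral_mkcond.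
  rewrite -ge0_integralZr//=; last 3 first.
  - rewrite epatch_indic; apply: emeasurable_funM => //.
    exact/measurable_EFinP.
  - by move=> y _; rewrite epatch_indic/= mule_ge0// lee_fin normal_pdf_ge0.
  - by rewrite lee_fin normal_pdf_ge0.
  apply: eq_integral => y _; rewrite epatch_indic/= -!EFinM /h/=; congr EFin.
  by ring.
rewrite (@fubini_tonelli _ _ T T R mu mu (EFin \o h))//=; last first.
  exact/measurable_EFinP.
rewrite [RHS]integral_mkcond; apply: eq_integral => y _.
rewrite epatch_indic/= /h/=.
under eq_integral do rewrite normal_pdfM// mulrA EFinM.
rewrite ge0_integralZl//=; last 2 first.
- by move=> x _; rewrite lee_fin normal_pdf_ge0.
- by rewrite lee_fin mulr_ge0 ?normal_pdf_ge0.
by rewrite integral_normal_pdf mule1 muleC EFinM.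
Qed.

Lemma gaussian_law_linear (a b : R) : exists s : R,
  forall A : set T, measurable A ->
  (normal_prob 0 1 \x normal_prob 0 1)%E
    [set t : T * T | A (a * t.1 + b * t.2)] = gaussian_law 0 s A.
Proof.
have [->|b0] := eqVneq b 0; last first.
  exists (Num.sqrt (a ^+ 2 + b ^+ 2)) => A mA; rewrite normal_prob_linear//.
  rewrite /gaussian_law gt_eqF// sqrtr_gt0.
  by rewrite ltr_wpDl ?sqr_ge0// exprn_even_gt0.
(* For [b = 0] the law is that of [a U], a Dirac mass at 0 when [a = 0] too. *)
exists a => A mA; have mB : measurable (affine 0 a @^-1` A).
  by rewrite -[X in measurable X]setTI; exact: measurable_affine.
rewrite (_ : [set _ | _] = (affine 0 a @^-1` A) `*` setT); last first.
  apply/seteqP; split => t /=; rewrite /affine mul0r addr0 add0r//.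
  by case.
rewrite product_measure1E// [X in (_ * X)%E]probability_setT mule1.
rewrite /gaussian_law; case: eqP => [->|/eqP a0]; last first.
  exact: normal_prob_affine.
rewrite diracE; case: (asboolP (A 0)) => A0.
- rewrite (_ : affine 0 0 @^-1` A = setT) ?mem_set//.
    exact: probability_setT.
  by apply/seteqP; split => t //=; rewrite /affine mul0r addr0.
- rewrite (_ : affine 0 0 @^-1` A = set0) ?measure0 ?memNset//.
  by apply/seteqP; split => t //=; rewrite /affine mul0r addr0.
Qed.

(** Were the integral zero, positivity of the density would make the interval Lebesgue null. *)
Lemma normal_prob_itv_gt0 (m s x y : R) : s != 0 -> x < y ->
  (0 < normal_prob m s `]x, y])%E.
Proof.
move=> s0 xy; rewrite lt0e measure_ge0 andbT; apply/eqP => N0.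
have mpdf : measurable_fun setT (fun x : T => (normal_pdf m s x)%:E).
  by apply/measurable_EFinP; exact: measurable_normal_pdf.
have pdf0 z : 0 < normal_pdf m s z.
  by rewrite normal_pdfE// mulr_gt0 ?normal_peak_gt0// expR_gt0.
have /ae_eq_integral_abs :
    (\int[mu]_(z in `]x, y]) `|(normal_pdf m s z)%:E| = 0)%E.
  rewrite -[RHS]N0 /normal_prob; apply: eq_integral => z _.
  by rewrite gee0_abs// lee_fin ltW.
move=> /(_ _)[] => [//||]; first exact: measurable_funTS.
move=> B [mB muB sub].
have : (mu `]x, y] <= mu B)%E.
  apply: le_measure; rewrite ?inE// => z xyz; apply: sub => /(_ xyz)[] /eqP.
  by rewrite gt_eqF.
rewrite muB lebesgue_measure_itv/= lte_fin xy -EFinB lee_fin.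
by rewrite leNgt subr_gt0 xy.
Qed.

(** The distribution function of the identity, seen as a random variable, tends to 0 at minus
    infinity. *)
Lemma normal_prob_itvNy_small (m s e : R) : 0 < e ->
  exists2 a : R, 0 < a & fine (normal_prob m s `]-oo, -a]) < e.
Proof.
move=> e0; pose X : {RV (normal_prob m s) >-> R} :=
  HB.pack (idfun : T -> R)
    (@isMeasurableFun.Build _ _ _ _ (idfun : T -> R) (@measurable_id _ _ setT)).
have /fine_cvgP[_ /cvgrPdist_lt/(_ _ e0)] := cvg_cdfNy0 X.
move=> [M [_ MP]]; exists (`|M| + 1); first by rewrite ltr_wpDl.
have lt1 : - (`|M| + 1) < M.
  by rewrite ltrNl (le_lt_trans (ler_norm _))// normrN ltrDl.
have := MP _ lt1; rewrite sub0r normrN ger0_norm ?fine_ge0//.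
Qed.

End Normal.

(** * The threshold vector *)
(** Here [u = P(V >= 0)], [v = P(V < 0)], [sp] and [sm] are the probabilities of [U + V <= 0]
    jointly with these events, and [q = P(U >= a)]. As [q] vanishes for large [a], the small atom
    [p110] is bounded relative to [q], and [x] and [e] are chosen before [q]. *)
Lemma rayleigh_gap (R : realFieldType) (u v sp sm : R) :
  0 < u -> 0 < v -> 0 <= sp -> sp * v < sm * u ->
  exists x e : R, 0 < e /\
  forall q p000 p001 p010 p011 p100 p101 p110 p111 : R,
    0 < q -> q <= 1 -> p101 = q * u -> p100 = q * v - p110 ->
    p011 = sp -> p010 = sm - p110 -> p111 = 0 ->
    0 <= p110 -> p110 <= q * e -> 0 <= p000 -> p001 <= 1 ->
    (p100 + p101 * x) * (p010 + p011 * x) <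
    (p000 + p001 * x) * (p110 + p111 * x).
Proof.
move=> u0 v0 sp0 lt; have spv0 : 0 <= sp * v by rewrite mulr_ge0// ltW.
have sm0 : 0 < sm by rewrite -(pmulr_lgt0 sm u0); exact: le_lt_trans lt.
pose D := sm * u + sp * v; have D0 : 0 < D by rewrite /D; lra.
(* The harmonic mean of [v / u] and [sm / sp], in a form that allows [sp = 0]. At [- x] the two
   affine factors have opposite signs, as the positivity of [w] and [k] records. *)
pose x := 2 * v * sm / D; have x0 : 0 < x by rewrite divr_gt0 ?mulr_gt0.
pose w := u * x - v; have w0 : 0 < w.
  rewrite /w /x mulrA subr_gt0 ltr_pdivlMr// /D.
  have : v * (sp * v) < v * (sm * u) by rewrite ltr_pM2l.
  by lra.
pose k := sm - sp * x; have k0 : 0 < k.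
  rewrite /k /x mulrA subr_gt0 ltr_pdivrMr// /D.
  have : sm * (sp * v) < sm * (sm * u) by rewrite ltr_pM2l.
  by lra.
have xw0 : 0 < 2 * (x + w) by rewrite mulr_gt0// addr_gt0.
(* From [e * (x + w) = k * w / 2] follow both [2 * e <= k] and [x * e < w * k / 2]. *)
pose e := k * w / (2 * (x + w)).
have e0 : 0 < e by rewrite divr_gt0// mulr_gt0.
have eE : e * (2 * (x + w)) = k * w by rewrite mulfVK ?gt_eqF.
exists (- x), e; split=> // q p0 p1 _ _ _ _ d _ q0 q1 -> -> -> -> ->.
move=> d0 dqe p00 p11; rewrite mul0r addr0.
have de : d <= e by rewrite (le_trans dqe)// ler_piMl// ltW.
have ek : 2 * e <= k.
  rewrite -(ler_pM2r w0); have : 0 <= e * x by rewrite mulr_ge0 ?ltW.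
  by move: eE; lra.
(* The left side of the goal is [- (q * w + d) * (k - d)] and the right side is at least [- x * d];
   both are compared with [- q * w * k / 2]. *)
have e1 : (q * w + d) * (k - d) >= q * w * (k / 2).
  apply: ler_pM; [by rewrite mulr_ge0 ?ltW|by rewrite divr_ge0 ?ltW|lra|lra].
have e2 : x * d <= q * (x * e) by rewrite mulrCA ler_pM2l.
have e3 : x * e < w * (k / 2).
  have : 0 < e * w by rewrite mulr_gt0.
  by move: eE; lra.
have e4 : q * (x * e) < q * (w * (k / 2)) by rewrite ltr_pM2l.
have e5 : 0 <= (1 - p1) * (x * d).
  by rewrite mulr_ge0 ?subr_ge0// mulr_ge0// ltW.
have e6 : 0 <= p0 * d by rewrite mulr_ge0.
move: e1 e2 e4 e5 e6; rewrite /w /k; lra.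
Qed.

(** * Probabilities as real numbers *)

Section FineProbability.
Context d (T : measurableType d) (R : realType) (P : probability T R).

Lemma fine_prob_le (A B : set T) : measurable A -> measurable B ->
  A `<=` B -> fine (P A) <= fine (P B).
Proof.
move=> mA mB AB; apply: fine_le; rewrite ?fin_num_measure//.
by apply: le_measure; rewrite ?inE.
Qed.

Lemma fine_probU (A B : set T) : measurable A -> measurable B ->
  A `&` B = set0 -> fine (P (A `|` B)) = fine (P A) + fine (P B).
Proof. by move=> mA mB AB; rewrite measureU// fineD// fin_num_measure. Qed.

Lemma fine_prob_le1 (A : set T) : measurable A -> fine (P A) <= 1.
Proof.
move=> mA; rewrite -[leRHS]/(fine 1%E).
by rewrite fine_le ?fin_num_measure// probability_le1.
Qed.

Lemma fine_prob_gt0 (A : set T) : measurable A -> (0 < P A)%E -> 0 < fine (P A).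
Proof.
by move=> mA PA; rewrite fine_gt0// PA -ge0_fin_numE// fin_num_measure.
Qed.

End FineProbability.

Lemma fine_prodX d1 d2 (T1 : measurableType d1) (T2 : measurableType d2)
    (R : realType) (P1 : probability T1 R) (P2 : probability T2 R) A B :
  measurable A -> measurable B ->
  fine ((P1 \x P2)%E (A `*` B)) = fine (P1 A) * fine (P2 B).
Proof.
by move=> mA mB; rewrite product_measure1E// fineM// fin_num_measure.
Qed.

Lemma fine_normal_prob_gt0 (R : realType) (m s : R) (I : interval R) (x y : R) :
  s != 0 -> x < y -> `]x, y] `<=` [set` I] ->
  0 < fine (normal_prob m s [set` I]).
Proof.
move=> s0 xy xyI; apply: fine_prob_gt0; first exact: measurable_itv.
apply: (lt_le_trans (normal_prob_itv_gt0 m s0 xy)).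
by apply: le_measure => //; rewrite inE; exact: measurable_itv.
Qed.

(** * The Gaussian model, its atoms and their probabilities *)

Section Model.
Context {R : realType}.
Local Notation T := (measurableTypeR R).
Local Notation N := (@normal_prob R 0 1).
Local Notation i1 := (lift ord0 ord0 : 'I_3).
Local Notation i2 := (lift ord0 (lift ord0 ord0) : 'I_3).

Definition gauss2 : probability (T * T)%type R := (N \x N)%E.

(** The coordinates sum to zero, so the covariance matrix is singular. *)
Definition coord_fun (i : 'I_3) (t : T * T) : R :=
  nth 0 [:: t.1; - t.1 - t.2; t.2] i.

Lemma measurable_coord_fun i : measurable_fun setT (coord_fun i).
Proof.
case: i => -[|[|[|//]]] i3; rewrite /coord_fun/=.
- exact: measurable_fst.
- by apply: measurable_funB => //; exact: measurableT_comp.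
- exact: measurable_snd.
Qed.

HB.instance Definition _ i :=
  isMeasurableFun.Build _ _ _ _ (coord_fun i) (measurable_coord_fun i).

Definition coord (i : 'I_3) : {RV gauss2 >-> R} := coord_fun i.

Definition level (a : R) (i : 'I_3) : R := nth 0 [:: a; 0; 0] i.

Lemma jointly_gaussian_coord : jointly_gaussian coord.
Proof.
move=> c; have [s sP] := gaussian_law_linear (c ord0 - c i1) (c i2 - c i1).
exists 0, s => A mA; rewrite -(sP _ mA); congr (gauss2 _).
apply/funext => t /=; rewrite /coord /coord_fun !big_ord_recl big_ord0 /= addr0.
by congr A; ring.
Qed.

Variable a : R.
Let X := threshold coord (level a).

Lemma thresholdE i t : X i t = (level a i <= coord_fun i t)%R%:R.
Proof.
rewrite /X /threshold /= /mindic indicE; congr (nat_of_bool _)%:R.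
by apply/idP/idP; rewrite inE.
Qed.

(** [U] raises only the indicator [ord0], [V] only [i2], and both lower only [i1]. *)
Lemma negatively_associated_threshold : negatively_associated X.
Proof.
have homo_bool (b c : bool) : (b -> c) -> (b%:R : R) <= c%:R.
  by rewrite ler_nat; case: b c => [] [] //= /(_ isT).
apply: (@negatively_associated_opposite_monotone _ N N 3 X ord0 i1 i2).
- by move=> i t; rewrite thresholdE ler0n lern1 leq_b1.
- move=> [[|[|[|//]]] i3] y //= _ x x' xx'; rewrite !thresholdE.
    by apply: homo_bool; rewrite /level /coord_fun/= => /le_trans; exact.
  by [].
- move=> [[|[|[|//]]] i3] y //= _ x x' xx'; rewrite !thresholdE.
    by apply: homo_bool; rewrite /level /coord_fun/=; lra.
  by [].
- move=> [[|[|[|//]]] i3] x //= _ y y' yy'; rewrite !thresholdE.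
    by [].
  by apply: homo_bool; rewrite /level /coord_fun/= => /le_trans; exact.
- move=> [[|[|[|//]]] i3] x //= _ y y' yy'; rewrite !thresholdE.
    by [].
  by apply: homo_bool; rewrite /level /coord_fun/=; lra.
Qed.

Definition literal (b : bool) (A : set (T * T)) : set (T * T) :=
  if b then A else ~` A.

Lemma measurable_literal b A : measurable A -> measurable (literal b A).
Proof. by case: b => // mA; exact: measurableC. Qed.

Let S0 : set (T * T) := [set t | a <= t.1].
Let S1 : set (T * T) := [set t | 0 <= - t.1 - t.2].
Let S2 : set (T * T) := [set t | 0 <= t.2].

(** [U >= a > 0] and [V >= 0] exclude [U + V <= 0], so the atom is a rectangle and its probability a
    product. *)
Lemma atom101 : 0 < a -> S0 `&` ~` S1 `&` S2 = `[a, +oo[ `*` `[0, +oo[.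
Proof.
move=> a0; apply/seteqP; split => t; rewrite /S0 /S1 /S2 /= !in_itv/= !andbT.
  by case=> [[]].
move=> [t1 t2]; split => //; split => //; apply/negP; rewrite -ltNge.
by move: a0 t1 t2; lra.
Qed.

(** The second event is left free: removing the atom [110] from this rectangle leaves the atom
    [100]. *)
Lemma atom1_0 : S0 `&` ~` S2 = `[a, +oo[ `*` `]-oo, 0[.
Proof.
apply/seteqP; split => t; rewrite /S0 /S1 /S2 /= !in_itv/= ?andbT => -[t1 t2];
  split => //.
  by rewrite ltNge; apply/negP.
by apply/negP; rewrite -ltNge.
Qed.

Lemma atom011 : 0 < a -> ~` S0 `&` S1 `&` S2 = S1 `&` S2.
Proof.
move=> a0; apply/seteqP; split => t; rewrite /S0 /S1 /S2 /=.
  by case=> [[]].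
move=> [t1 t2]; split => //; split => //; apply/negP; rewrite -ltNge.
by move: a0 t1 t2; lra.
Qed.

Lemma atom111 : 0 < a -> S0 `&` S1 `&` S2 = set0.
Proof.
move=> a0; apply/seteqP; split => t; rewrite /S0 /S1 /S2 //= => -[[]] + +.
by move: a0; lra.
Qed.

(** [V <= - U <= - a] confines this atom to a rectangle of probability small relative to that of
    [U >= a]. *)
Lemma atom110 : S0 `&` S1 `&` ~` S2 `<=` `[a, +oo[ `*` `]-oo, -a].
Proof.
move=> t; rewrite /S0 /S1 /S2 /= => -[[t0 t1] /negP]; rewrite -ltNge => t2.
rewrite !in_itv/= andbT.
by split => //; move: t0 t1 t2; lra.
Qed.

Let mS0 : measurable S0.
Proof. exact: (measurable_superlevel (coord ord0)). Qed.
Let mS1 : measurable S1.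
Proof. exact: (measurable_superlevel (coord i1)). Qed.
Let mS2 : measurable S2.
Proof. exact: (measurable_superlevel (coord i2)). Qed.

Lemma cube_law_threshold b0 b1 b2 :
  cube_law X (cube3 b0 b1 b2) =
  fine (gauss2 (literal b0 S0 `&` literal b1 S1 `&` literal b2 S2)).
Proof.
rewrite /cube_law; congr (fine (gauss2 _)).
have litE (b : bool) (Q : T * T -> bool) t :
    (Q t)%:R = b%:R :> R <-> literal b [set t | Q t] t.
  apply: (@iff_trans _ (Q t = b)).
    by split=> [/eqP|->//]; rewrite eqr_nat; case: (Q t) b => [] [].
  by rewrite /literal; case: b => //; split=> [/= ->//|/negP/negbTE].
apply/seteqP; split => [t Xt|t [[L0 L1] L2] /= i].
  have Xi i : (level a i <= coord_fun i t)%R%:R = (cube3 b0 b1 b2 i)%:R :> R.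
    by rewrite -thresholdE; exact: Xt.
  split; [split|]; apply/litE; [move: (Xi ord0)|move: (Xi i1)|move: (Xi i2)];
    by rewrite ffunE.
rewrite thresholdE ffunE.
case: i => -[|[|[|//]]] i3; rewrite /level /coord_fun/=.
- by apply/(litE b0 (fun t => a <= t.1)).
- by apply/(litE b1 (fun t => 0 <= - t.1 - t.2)).
- by apply/(litE b2 (fun t => 0 <= t.2)).
Qed.

Lemma cube_law_threshold_itv b0 b1 b2 :
  0 <= cube_law X (cube3 b0 b1 b2) <= 1.
Proof.
rewrite cube_law_threshold; apply/andP; split.
  exact: fine_ge0 (measure_ge0 _ _).
apply: fine_prob_le1; apply: measurableI; last exact: measurable_literal _ mS2.
exact: measurableI _ _ (measurable_literal _ mS0) (measurable_literal _ mS1).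
Qed.

Lemma fine_gauss2_literal (A B : set (T * T)) : measurable A -> measurable B ->
  fine (gauss2 (A `&` B)) + fine (gauss2 (A `&` ~` B)) = fine (gauss2 A).
Proof.
move=> mA mB; rewrite -fine_probU; last 3 first.
- exact: measurableI.
- by apply: measurableI => //; exact: measurableC.
- by rewrite setIACA setICr setI0.
by rewrite -setIUr setUCr setIT.
Qed.

(** Puts the atoms in the form that [rayleigh_gap] expects, [100] and [010] being two-event
    probabilities less [d]. *)
Lemma rayleigh_coefficients : 0 < a ->
  let p b0 b1 b2 := cube_law X (cube3 b0 b1 b2) in
  let q := fine (N `[a, +oo[) in
  let d := p true true false in
  [/\ p true false true = q * fine (N `[0, +oo[),
      p true false false = q * fine (N `]-oo, 0[) - d,
      p false true true = fine (gauss2 (S1 `&` S2)),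
      p false true false = fine (gauss2 (S1 `&` ~` S2)) - d &
      p true true true = 0 /\ 0 <= d <= q * fine (N `]-oo, -a])].
Proof.
move=> a0 p q d.
have mN2 : measurable (~` S2) by exact: measurableC.
have dE : d = fine (gauss2 (S0 `&` S1 `&` ~` S2)) by exact: cube_law_threshold.
have m02 := measurableI _ _ mS0 mN2; have m12 := measurableI _ _ mS1 mN2.
have m012 := measurableI _ _ (measurableI _ _ mS0 mS1) mN2.
split.
- rewrite /p cube_law_threshold [X in gauss2 X](atom101 a0).
  rewrite -[RHS](fine_prodX N N (measurable_itv _) (measurable_itv _)).
  reflexivity.
- rewrite -(fine_prodX N N (measurable_itv _) (measurable_itv _)) -atom1_0.
  rewrite -[X in _ = X - _](fine_gauss2_literal m02 mS1) dE.
  rewrite (setIAC S0 _ S1) addrAC subrr add0r /p cube_law_threshold setIAC.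
  reflexivity.
- rewrite /p cube_law_threshold [X in gauss2 X](atom011 a0).
  reflexivity.
- rewrite -[X in _ = X - _](fine_gauss2_literal m12 mS0) dE.
  rewrite (setIC (S1 `&` _) S0) (setIA S0) addrAC subrr add0r.
  rewrite /p cube_law_threshold (setIC (S1 `&` _)) (setIA (~` S0)).
  reflexivity.
split.
  by rewrite /p cube_law_threshold [X in gauss2 X](atom111 a0) measure0.
rewrite dE; apply/andP; split; first exact: fine_ge0 (measure_ge0 _ _).
rewrite -(fine_prodX N N (measurable_itv _) (measurable_itv _)).
apply: (fine_prob_le gauss2 m012 _ atom110).
exact: (measurableX (measurable_itv _) (measurable_itv _)).
Qed.

(** With [h = P(U <= 0)], the event [S1] lies inside [U <= 0] when [V >= 0] and contains it when
    [V < 0], so the two sides are separated by [h * u * v]. *)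
Lemma negative_correlation_gap :
  let u := fine (N `[0, +oo[) in let v := fine (N `]-oo, 0[) in
  [/\ 0 < u, 0 < v &
      fine (gauss2 (S1 `&` S2)) * v < fine (gauss2 (S1 `&` ~` S2)) * u].
Proof.
move=> u v.
have u0 : 0 < u.
  apply: (@fine_normal_prob_gt0 _ 0 1 _ 0 1) => // x /=.
  by rewrite !in_itv/= andbT => /andP[/ltW].
have v0 : 0 < v.
  by apply: (@fine_normal_prob_gt0 _ 0 1 _ (-2) (-1)) => [||x /=];
    rewrite ?oner_neq0 ?in_itv//=; lra.
have k1 : 0 < fine (N `]0, 1]) by apply: (@fine_normal_prob_gt0 _ 0 1 _ 0 1).
have k2 : 0 < fine (N `]-oo, -1]).
  by apply: (@fine_normal_prob_gt0 _ 0 1 _ (-2) (-1)) => [||x /=];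
    rewrite ?oner_neq0 ?in_itv//=; lra.
pose h := fine (N `]-oo, 0]).
have mX (I J : interval R) : measurable ([set` I] `*` [set` J] : set (T * T)).
  exact: (measurableX (measurable_itv _) (measurable_itv _)).
have m12 := measurableI _ _ mS1 mS2.
have m1N2 := measurableI _ _ mS1 (measurableC mS2).
have spu : fine (gauss2 (S1 `&` S2)) <= h * u.
  rewrite -(fine_prodX N N (measurable_itv _) (measurable_itv _)).
  apply: (fine_prob_le gauss2 m12 (mX _ _)) => t; rewrite /S1 /S2 /=.
  by rewrite !in_itv/= andbT; lra.
(* The second rectangle, where [0 < U <= 1] and [V <= -1], makes the final inequality strict. *)
have smv : h * v + fine (N `]0, 1]) * fine (N `]-oo, -1]) <=
    fine (gauss2 (S1 `&` ~` S2)).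
  rewrite -!(fine_prodX N N (measurable_itv _) (measurable_itv _)).
  rewrite -(fine_probU gauss2 (mX _ _) (mX _ _)); last first.
    by apply/seteqP; split => t //=; rewrite !in_itv/=; lra.
  apply: (fine_prob_le gauss2 (measurableU _ _ (mX _ _) (mX _ _)) m1N2) => t.
  rewrite /S1 /S2 /= !in_itv/= => tP; split; last apply/negP.
    by case: tP; lra.
  by rewrite -ltNge; case: tP; lra.
split => //; apply: (@le_lt_trans _ _ (h * u * v)); first by rewrite ler_pM2r.
rewrite mulrAC ltr_pM2r//; apply: lt_le_trans smv.
by rewrite ltrDl mulr_gt0.
Qed.

End Model.

Lemma not_strongly_rayleigh_threshold (R : realType) :
  exists a : R, ~ strongly_rayleigh (cube_law (threshold coord (level a))).
Proof.
have [u0 v0 gap] := @negative_correlation_gap R.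
have sp0 := fine_ge0 (measure_ge0 (@gauss2 R) _).
(* The gap does not involve [a], so [x] and [e] are fixed first and [a] is then taken with
   [P(V <= - a) < e]. *)
have [x [e [e0 xe]]] := rayleigh_gap u0 v0 (sp0 _) gap.
have [a a0 ae] := normal_prob_itvNy_small 0 1 e0.
exists a.
have [p101 p100 p011 p010 [p111 /andP[d0 dle]]] := rayleigh_coefficients a0.
have q0 : 0 < fine (normal_prob 0 1 `[a, +oo[).
  apply: (@fine_normal_prob_gt0 _ 0 1 _ a (a + 1)) => [||y /=].
  - exact: oner_neq0.
  - by rewrite ltrDl.
  - by rewrite !in_itv/= andbT => /andP[/ltW].
apply: (@not_strongly_rayleigh3 R _ x).
apply: (xe _ _ _ _ _ _ _ _ _ q0 _ p101 p100 p011 p010 p111 d0).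
- by apply: fine_prob_le1; exact: measurable_itv.
- exact: le_trans dle (ler_wpM2l (ltW q0) (ltW ae)).
- by have /andP[] := cube_law_threshold_itv a false false false.
- by have /andP[] := cube_law_threshold_itv a false false true.
Qed.

Theorem corollary3p10 (R : realType) :
  exists (n : nat) (d : measure_display) (T : measurableType d)
         (P : probability T R) (Z : 'I_n -> {RV P >-> R}) (a : 'I_n -> R),
    jointly_gaussian Z /\
    negatively_associated (threshold Z a) /\
    ~ strongly_rayleigh (cube_law (threshold Z a)).
Proof.
have [a nSR] := not_strongly_rayleigh_threshold R.
exists 3%N, _, _, gauss2, coord, (level a).
split; first exact: jointly_gaussian_coord.
by split; first exact: negatively_associated_threshold.
Qed.
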